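(* Let $\Phi=(G,\varphi)$ be a $\mathbb{T}$-gain graph on a $2$-connected non-geodetic graph $G$. Then $\Phi$ is not distance compatible if and only if there exists an unbalanced even cycle $C$ in $\Phi$, of length $2l$ say, containing two diametrically opposite vertices $s,t$ (i.e. at distance $l$ along $C$) such that there is no path between $s$ and $t$ in $G$ of length smaller than $l$.
   Context: $\mathbb{T}=\{z\in\mathbb{C}:|z|=1\}$. A $\mathbb{T}$-gain graph $\Phi=(G,\varphi)$ on a simple graph $G$ with vertices $v_1,\dots,v_n$ assigns to each oriented edge $\overrightarrow{e}_{i,j}$ an element $\varphi(\overrightarrow{e}_{i,j})\in\mathbb{T}$ with $\varphi(\overrightarrow{e}_{j,i})=\varphi(\overrightarrow{e}_{i,j})^{-1}$. The gain of an oriented path or cycle is the product of the gains of its consecutive oriented edges; a cycle is unbalanced if its gain is not $1$. $G$ is geodetic if every two vertices are joined by a unique shortest path. $d(s,t)$ is the graph distance. $\mathcal{P}(s,t)$ is the set of oriented shortest paths from $s$ to $t$; $\mathcal{P}^{\max}(s,t)$ (resp. $\mathcal{P}^{\min}(s,t)$) is the set of those whose gain has maximum (resp. minimum) real part in $\mathcal{P}(s,t)$. For a total order $<$ and $s<t$, $\varphi^{<}_{\max}(s,t)$ is the gain of a path in $\mathcal{P}^{\max}(s,t)$ with maximum imaginary part of gain among paths in $\mathcal{P}^{\max}(s,t)$, and $\varphi^{<}_{\max}(t,s)=\overline{\varphi^{<}_{\max}(s,t)}$; $\varphi^{<}_{\min}(s,t)$ is the gain of a path in $\mathcal{P}^{\min}(s,t)$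 with minimum imaginary part of gain among paths in $\mathcal{P}^{\min}(s,t)$, and $\varphi^{<}_{\min}(t,s)=\overline{\varphi^{<}_{\min}(s,t)}$. $D^{\max}_{<}(\Phi)=(\varphi^{<}_{\max}(v_i,v_j)d(v_i,v_j))$, $D^{\min}_{<}(\Phi)=(\varphi^{<}_{\min}(v_i,v_j)d(v_i,v_j))$. $\Phi$ is distance compatible if $D^{\max}_{<}(\Phi)=D^{\min}_{<}(\Phi)$ for the standard order $v_1<\dots<v_n$. *)

(* Defs.v *)
From HB Require Import structures.
From mathcomp Require Import all_boot all_order all_algebra.
From mathcomp Require Import complex reals.

Set Implicit Arguments.
Unset Strict Implicit.
Unset Printing Implicit Defensive.

Import Order.TTheory GRing.Theory Num.Theory.
Local Open Scope ring_scope.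

(* The vertices v_1, ..., v_n are the elements of 'I_n. *)
Record sgraph (n : nat) := SGraph {
  adj :> rel 'I_n;
  adj_sym : symmetric adj;
  adj_irrefl : irreflexive adj }.

(* [gain_fun] is total; its values are only constrained, and only used, on the
   oriented edges of G. *)
Record gain_graph (R : realType) (n : nat) (G : sgraph n) := GainGraph {
  gain_fun :> 'I_n -> 'I_n -> R[i];
  gain_norm : forall i j, G i j -> `|gain_fun i j| = 1;
  gain_inv : forall i j, G i j -> gain_fun j i = (gain_fun i j)^-1 }.

Section Graph.
Variables (n : nat) (G : sgraph n).

(* The path s :: p; its length is size p. *)
Definition is_path (s t : 'I_n) (p : seq 'I_n) : bool :=
  [&& path G s p, last s p == t & uniq (s :: p)].

(* The cycle visits the vertices of c in order and then returns to the first. *)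
Definition is_cycle (c : seq 'I_n) : bool :=
  [&& (3 <= size c)%N, uniq c & cycle G c].

(* Least length of a path from s to t (a path has length < n); the value is n
   when there is no such path. *)
Definition dist (s t : 'I_n) : nat :=
  find (fun k => [exists p : k.-tuple 'I_n, is_path s t p]) (iota 0 n).

Definition geodesics (s t : 'I_n) : {set (dist s t).-tuple 'I_n} :=
  [set p : (dist s t).-tuple 'I_n | is_path s t p].

Definition geodetic : Prop :=
  forall s t : 'I_n, exists! p, p \in geodesics s t.

Definition connected_minus (X : {set 'I_n}) : Prop :=
  forall u v : 'I_n, u \notin X -> v \notin X ->
    connect [rel a b | [&& G a b, a \notin X & b \notin X]] u v.

Definition k_connected (k : nat) : Prop :=
  (k < n)%N /\ forall X : {set 'I_n}, (#|X| < k)%N -> connected_minus X.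

End Graph.

(* Distance between the vertices s and t of c when moving along the cycle c. *)
Definition cycle_dist (T : eqType) (c : seq T) (s t : T) : nat :=
  let k := (maxn (index s c) (index t c) - minn (index s c) (index t c))%N in
  minn k (size c - k).

Section Gain.
Variables (R : realType) (n : nat) (G : sgraph n) (Phi : gain_graph R G).

Definition path_gain (s : 'I_n) (p : seq 'I_n) : R[i] :=
  \prod_(z <- pairmap Phi s p) z.

Definition cycle_gain (c : seq 'I_n) : R[i] :=
  if c is x :: p then path_gain x (rcons p x) else 1.

Definition unbalanced (c : seq 'I_n) : Prop := cycle_gain c <> 1.

Definition geodesics_max (s t : 'I_n) : {set (dist G s t).-tuple 'I_n} :=
  [set p in geodesics G s t |
    [forall q in geodesics G s t,
       complex.Re (path_gain s q) <= complex.Re (path_gain s p)]].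

Definition geodesics_min (s t : 'I_n) : {set (dist G s t).-tuple 'I_n} :=
  [set p in geodesics G s t |
    [forall q in geodesics G s t,
       complex.Re (path_gain s p) <= complex.Re (path_gain s q)]].

(* All the paths that [pick] may return have the same gain, since the real and
   the imaginary part of the gain are both prescribed; the default 0 is reached
   only if t is not reachable from s. *)
Definition max_gain (s t : 'I_n) : R[i] :=
  oapp (fun p : (dist G s t).-tuple 'I_n => path_gain s p) 0
    [pick p in geodesics_max s t |
      [forall q in geodesics_max s t,
         complex.Im (path_gain s q) <= complex.Im (path_gain s p)]].

Definition min_gain (s t : 'I_n) : R[i] :=
  oapp (fun p : (dist G s t).-tuple 'I_n => path_gain s p) 0
    [pick p in geodesics_min s t |
      [forall q in geodesics_min s t,
         complex.Im (path_gain s p) <= complex.Im (path_gain s q)]].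

(* lt is a strict total order on the vertices. On the diagonal both functions
   give the gain 1 of the trivial path. *)
Definition phi_max (lt : rel 'I_n) (s t : 'I_n) : R[i] :=
  if lt s t then max_gain s t else conjc (max_gain t s).

Definition phi_min (lt : rel 'I_n) (s t : 'I_n) : R[i] :=
  if lt s t then min_gain s t else conjc (min_gain t s).

Definition Dmax (lt : rel 'I_n) : 'M[R[i]]_n :=
  \matrix_(i, j) (phi_max lt i j * (dist G i j)%:R).

Definition Dmin (lt : rel 'I_n) : 'M[R[i]]_n :=
  \matrix_(i, j) (phi_min lt i j * (dist G i j)%:R).

Definition std_lt : rel 'I_n := [rel i j : 'I_n | (i < j)%N].

Definition distance_compatible : Prop := Dmax std_lt = Dmin std_lt.

End Gain.

(* Main.v *)
Require Import Defs.
From mathcomp Require Import all_boot all_order all_algebra.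
From mathcomp Require Import complex reals.
From mathcomp Require Import zify boolp.

(** A lexicographic maximum and minimum coincide only on a constant family, so
    [Phi] is distance compatible iff all shortest paths between two given
    vertices have the same gain. Two shortest paths from [s] to [t] with
    different gains and no common inner vertex bound an unbalanced even cycle on
    which [s] and [t] are opposite, and every such cycle arises in this way. If
    the two paths do have a common inner vertex, it is at the same distance from
    [s] along both, hence splits them into two shorter pairs of shortest paths
    with common ends, one of which still has different gains; so a pair of
    minimal length is internally disjoint. *)

Set Implicit Arguments.
Unset Strict Implicit.
Unset Printing Implicit Defensive.

Import Order.TTheory GRing.Theory Num.Theory.

Section Walks.
Variables (T : eqType) (e : rel T).
Implicit Types (s t : T) (p q : seq T).

Definition rev_walk s p : seq T := rev (belast s p).

Lemma size_rev_walk s p : size (rev_walk s p) = size p.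
Proof. by rewrite size_rev size_belast. Qed.

Lemma last_rev_walk s p : last (last s p) (rev_walk s p) = s.
Proof. by case: p => //= a p; rewrite /rev_walk rev_cons last_rcons. Qed.

Lemma rev_walk_cons s a p : rev_walk s (a :: p) = rcons (rev_walk a p) s.
Proof. by rewrite /rev_walk rev_cons. Qed.

Lemma rev_walk_rcons s p t : rev_walk s (rcons p t) = rcons (rev p) s.
Proof. by rewrite /rev_walk belast_rcons rev_cons. Qed.

Lemma path_rev_walk s p :
  symmetric e -> path e (last s p) (rev_walk s p) = path e s p.
Proof. by move=> sym_e; rewrite rev_path; apply: eq_path => a b /=. Qed.

Definition min_walk s p : Prop :=
  path e s p /\
  forall q, path e s q -> last s q = last s p -> size p <= size q.

Lemma min_walk_path s p : min_walk s p -> path e s p.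
Proof. by case. Qed.

Lemma min_walk_nil s : min_walk s [::].
Proof. by []. Qed.

Lemma min_walk_eq_size s p q :
  min_walk s p -> min_walk s q -> last s p = last s q -> size p = size q.
Proof.
by move=> [sp minp] [sq minq] lpq; apply/eqP; rewrite eqn_leq minp ?minq.
Qed.

Lemma min_walk_uniq s p : min_walk s p -> uniq (s :: p).
Proof.
case=> sp; case/shortenP: (sp) => q sq uq sub minp.
have uq' : uniq q by case/andP: uq.
have [szq eq_qp] := uniq_min_size uq' sub (minp _ sq erefl).
by move: uq; rewrite /= eq_qp (eq_uniq szq eq_qp).
Qed.

Lemma min_walk_cat s p q :
  min_walk s (p ++ q) -> min_walk s p /\ min_walk (last s p) q.
Proof.
case; rewrite cat_path => /andP[sp pq] minpq; split; split=> // r sr lr.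
  have := minpq (r ++ q).
  by rewrite !cat_path !last_cat lr sr pq !size_cat leq_add2r; apply.
have := minpq (p ++ r).
by rewrite !cat_path !last_cat lr sp sr !size_cat leq_add2l; apply.
Qed.

Lemma min_walk_rev s p :
  symmetric e -> min_walk s p -> min_walk (last s p) (rev_walk s p).
Proof.
move=> sym_e [sp minp]; split=> [|q sq]; first by rewrite path_rev_walk.
rewrite last_rev_walk size_rev_walk => lq.
have := last_rev_walk (last s p) q; have := path_rev_walk (last s p) q sym_e.
by rewrite lq sq => sr lr; rewrite -(size_rev_walk (last s p) q) minp.
Qed.

End Walks.

Section Bigon.
Variable T : eqType.
Implicit Types (s t : T) (p q c : seq T).

(* The closed walk that follows p from s to t and then q backwards from t to s;
   p and q list the inner vertices only. *)
Definition bigon s p t q : seq T := s :: p ++ t :: rev q.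

Lemma size_bigon s p t q : size (bigon s p t q) = (size p + size q).+2.
Proof. by rewrite /= size_cat /= size_rev addnS. Qed.

Lemma uniq_bigon s p t q :
  uniq (bigon s p t q) =
  [&& uniq (s :: rcons p t), uniq (s :: rcons q t) & ~~ has (mem q) p].
Proof.
rewrite /bigon /= cat_uniq /= !rcons_uniq mem_cat !mem_rcons !inE !mem_rev.
rewrite rev_uniq has_rev has_sym !negb_or.
by case: (s \in p); case: (s == t); case: (s \in q); case: (t \in p);
  case: (uniq p); case: (t \in q); case: (uniq q); rewrite ?andbF ?andbT.
Qed.

Lemma cycle_bigon (e : rel T) s p t q : symmetric e ->
  cycle e (bigon s p t q) = path e s (rcons p t) && path e s (rcons q t).
Proof.
move=> sym_e; rewrite /= rcons_cat -cat_rcons cat_path last_rcons.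
by rewrite -(path_rev_walk s (rcons q t)) // last_rcons rev_walk_rcons.
Qed.

Lemma rot_to_bigon c s t : uniq c -> s \in c -> t \in c -> s != t ->
  exists i p q, rot i c = bigon s p t q.
Proof.
move=> uc sc tc st; have [i p q _ _ cE] := rot_to_arc uc sc tc st.
by exists i, p, (rev q); rewrite cE /bigon revK.
Qed.

Lemma cycle_distxx c s : cycle_dist c s s = 0.
Proof. by rewrite /cycle_dist maxnn minnn subnn min0n. Qed.

Lemma cycle_dist_catC p q s t : uniq (p ++ q) -> s \in p ++ q -> t \in p ++ q ->
  cycle_dist (p ++ q) s t = cycle_dist (q ++ p) s t.
Proof.
rewrite cat_uniq => /and3P[_ /hasPn disj _].
have index_catC x : x \in p ++ q ->
    index x (q ++ p) = if x \in p then size q + index x p else index x q.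
  rewrite mem_cat index_cat => /orP[xp|xq].
    by rewrite xp ifN //; apply: contraL xp; apply: disj.
  by rewrite xq (negbTE (disj x xq)).
move=> sc tc; rewrite /cycle_dist !index_catC // !index_cat !size_cat.
have [le_s le_t] := (index_size s q, index_size t q).
have [lt_s lt_t] := (index_mem s p, index_mem t p).
by case: ifP => sp; case: ifP => tp; lia.
Qed.

Lemma cycle_dist_rot i c s t : uniq c -> s \in c -> t \in c ->
  cycle_dist (rot i c) s t = cycle_dist c s t.
Proof.
move=> uc sc tc; rewrite -[in RHS](cat_take_drop i c).
by rewrite cycle_dist_catC ?cat_take_drop.
Qed.

Lemma cycle_dist_bigon s p t q : uniq (bigon s p t q) ->
  cycle_dist (bigon s p t q) s t = minn (size p).+1 (size q).+1.
Proof.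
rewrite uniq_bigon => /and3P[/= /andP[+ +] _ _].
rewrite mem_rcons inE negb_or rcons_uniq => /andP[st _] /andP[tp _].
rewrite /cycle_dist size_bigon /= eqxx (negbTE st) index_cat (negbTE tp) /=.
by rewrite eqxx; lia.
Qed.

End Bigon.

Section PathsAndDistance.
Variables (n : nat) (G : sgraph n).
Implicit Types (s t : 'I_n) (p q c : seq 'I_n).

Lemma is_cycle_rot i c : is_cycle G (rot i c) = is_cycle G c.
Proof. by rewrite /is_cycle size_rot rot_uniq rot_cycle. Qed.

Lemma is_path_size_lt s t p : is_path G s t p -> size p < n.
Proof.
case/and3P=> _ _ /card_uniqP /= <-.
by apply: leq_trans (max_card _) _; rewrite card_ord.
Qed.

Lemma path_is_path s p : path G s p ->
  exists2 q, is_path G s (last s p) q & size q <= size p.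
Proof.
move=> sp; case/shortenP: sp => q sq uq sub; exists q.
  by rewrite /is_path sq uq eqxx.
by apply: uniq_leq_size => //; case/andP: uq.
Qed.

Lemma min_walk_is_path s p : min_walk G s p -> is_path G s (last s p) p.
Proof.
by move=> mp; rewrite /is_path (min_walk_path mp) eqxx (min_walk_uniq mp).
Qed.

Lemma min_walk_is_pathP s t p : is_path G s t p ->
  min_walk G s p <-> ~ exists q, is_path G s t q /\ size q < size p.
Proof.
case/and3P=> sp /eqP lp _; split=> [[_ minp] [q [/and3P[sq /eqP lq _]]]|short].
  by rewrite ltnNge minp // lq.
split=> // q /path_is_path[r pr le_rq] lq; rewrite lq lp in pr.
rewrite leqNgt; apply/negP => lt_qp; apply: short; exists r; split=> //.
exact: leq_ltn_trans lt_qp.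
Qed.

Lemma is_cycle_bigon s p t q :
  is_cycle G (bigon s p t q) =
  [&& 0 < size p + size q, is_path G s t (rcons p t),
      is_path G s t (rcons q t) & ~~ has (mem q) p].
Proof.
rewrite /is_cycle /is_path size_bigon uniq_bigon.
rewrite (cycle_bigon _ _ _ _ (@adj_sym _ G)) !last_rcons eqxx !ltnS.
by case: (path G s (rcons p t)); case: (path G s (rcons q t));
  rewrite ?andbF ?andbT ?andbA.
Qed.

Lemma dist_le s p : path G s p -> dist G s (last s p) <= size p.
Proof.
case/path_is_path=> q pq; apply: leq_trans; rewrite leqNgt; apply/negP.
move/(before_find 0); rewrite nth_iota ?(is_path_size_lt pq) // => /existsP[].
by exists (in_tuple q).
Qed.

Lemma dist_attained s t p : is_path G s t p ->
  exists2 q, is_path G s t q & size q = dist G s t.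
Proof.
move=> pp; set joined := fun k => [exists q : k.-tuple 'I_n, is_path G s t q].
have has_joined : has joined (iota 0 n).
  apply/hasP; exists (size p); first by rewrite mem_iota (is_path_size_lt pp).
  by apply/existsP; exists (in_tuple p).
have := nth_find 0 has_joined; rewrite nth_iota; last first.
  by rewrite -[ltnRHS](size_iota 0) -has_find.
by case/existsP=> q pq; exists q => //; rewrite size_tuple.
Qed.

Lemma min_walk_size s p : min_walk G s p -> size p = dist G s (last s p).
Proof.
move=> mp; apply/eqP; rewrite eqn_leq dist_le ?andbT ?(min_walk_path mp) //.
have [q /and3P[sq /eqP lq _] <-] := dist_attained (min_walk_is_path mp).
by case: mp => _; apply.
Qed.

Lemma geodesic_min_walk s t (p : (dist G s t).-tuple 'I_n) :
  p \in geodesics G s t -> min_walk G s p /\ last s p = t.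
Proof.
rewrite inE => /and3P[sp /eqP lp _]; split=> //; split=> // q sq lq.
by have := dist_le sq; rewrite size_tuple lq lp.
Qed.

Lemma min_walk_geodesic s t p : min_walk G s p -> last s p = t ->
  exists2 q : (dist G s t).-tuple 'I_n, q \in geodesics G s t & tval q = p.
Proof.
move=> mp <-; have/eqP szp := min_walk_size mp.
by exists (Tuple szp) => //; rewrite inE min_walk_is_path.
Qed.

Lemma dist_eq0 s t : (dist G s t == 0) = (s == t).
Proof.
apply/eqP/eqP => [|<-]; last first.
  by apply/eqP; rewrite -leqn0; apply: (@dist_le s [::]).
have iotaE : iota 0 n = 0 :: iota 1 n.-1.
  by rewrite -[in LHS](prednK (leq_ltn_trans _ (ltn_ord s))).
rewrite /dist iotaE /=; case: existsP => // -[p /and3P[_ /eqP lp _]] _.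
by rewrite -lp tuple0.
Qed.

End PathsAndDistance.

Section LexicographicExtremum.
Local Open Scope ring_scope.

Definition argmin (T : finType) (U : eqType) (le : rel U) (A : {set T})
    (f : T -> U) : {set T} :=
  [set x in A | [forall y in A, le (f x) (f y)]].

Lemma argmin_neq0 (T : finType) (U : eqType) (le : rel U) (A : {set T})
    (f : T -> U) :
  total le -> transitive le -> A != set0 -> argmin le A f != set0.
Proof.
move=> le_total le_trans /set0Pn[x0 x0A].
have le_refl : reflexive le by move=> a; case/orP: (le_total a a).
have [x xA minx] :=
  @extremumP _ _ le x0 (mem A) f le_refl le_trans le_total x0A.
apply/set0Pn; exists x; rewrite inE; apply/andP; split=> //.
exact/forall_inP.
Qed.

Variables (R : realDomainType) (T : finType).
Implicit Types (le : rel R) (A : {set T}) (z : T -> R[i]).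

Definition lex_min le A z : R[i] :=
  let minRe := argmin le A (fun x => complex.Re (z x)) in
  oapp z 0 [pick x in minRe |
    [forall y in minRe, le (complex.Im (z x)) (complex.Im (z y))]].

Lemma lex_min0 le z : lex_min le set0 z = 0.
Proof. by rewrite /lex_min; case: pickP => // x /andP[]; rewrite !inE. Qed.

Lemma lex_minP le A z : total le -> transitive le -> A != set0 ->
  exists2 x, x \in A & lex_min le A z = z x /\
    {in A, forall y, le (complex.Re (z x)) (complex.Re (z y)) /\
      (complex.Re (z x) = complex.Re (z y) ->
       le (complex.Im (z x)) (complex.Im (z y)))}.
Proof.
move=> le_total le_trans A0; rewrite /lex_min.
case: pickP => [x /andP[]|none] /=.
  rewrite inE => /andP[xA /forall_inP minRe] /forall_inP minIm.
  exists x => //; split=> // y yA; split; first exact: minRe.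
  move=> eqRe; apply: minIm; rewrite inE yA /=.
  by apply/forall_inP => w wA; rewrite -eqRe minRe.
have Re0 := argmin_neq0 (fun x => complex.Re (z x)) le_total le_trans A0.
have := argmin_neq0 (fun x => complex.Im (z x)) le_total le_trans Re0.
by case/set0Pn=> x; rewrite inE none.
Qed.

Lemma lex_max_min_eqP A z :
  lex_min >=%R A z = lex_min <=%R A z <-> {in A &, forall x y, z x = z y}.
Proof.
have [-> | A0] := eqVneq A set0.
  by rewrite !lex_min0; split=> // _ x y; rewrite inE.
have [x xA [-> maxx]] := lex_minP z (@ge_total _ R) ge_trans A0.
have [y yA [-> miny]] := lex_minP z (@le_total _ R) le_trans A0.
split=> [xy|zE]; last exact: zE.
suff zE w : w \in A -> z w = z x by move=> v w vA wA; rewrite !zE.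
move=> wA; have [maxRe maxIm] := maxx w wA; have [minRe minIm] := miny w wA.
rewrite -xy in minRe minIm.
have eqRe : complex.Re (z x) = complex.Re (z w) by apply/le_anti/andP.
apply/eqP; rewrite eq_complex eqRe eqxx; apply/eqP/le_anti/andP.
by split; [apply: maxIm | apply: minIm].
Qed.

End LexicographicExtremum.

Section Gain.
Local Open Scope ring_scope.
Variables (R : realType) (n : nat) (G : sgraph n) (Phi : gain_graph R G).
Implicit Types (s t : 'I_n) (p q c : seq 'I_n).

Lemma path_gain_nil s : path_gain Phi s [::] = 1.
Proof. exact: big_nil. Qed.

Lemma path_gain_cons s x p :
  path_gain Phi s (x :: p) = Phi s x * path_gain Phi x p.
Proof. exact: big_cons. Qed.

Lemma path_gain_cat s p q :
  path_gain Phi s (p ++ q) = path_gain Phi s p * path_gain Phi (last s p) q.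
Proof.
elim: p s => [|x p IH] s /=; first by rewrite path_gain_nil mul1r.
by rewrite !path_gain_cons IH mulrA.
Qed.

Lemma path_gain_neq0 s p : path G s p -> path_gain Phi s p != 0.
Proof.
elim: p s => [|x p IH] s /=; first by rewrite path_gain_nil oner_neq0.
case/andP=> sx xp; rewrite path_gain_cons mulf_neq0 ?IH //.
by rewrite -normr_eq0 gain_norm // oner_neq0.
Qed.

Lemma path_gain_rev s p : path G s p ->
  path_gain Phi (last s p) (rev_walk s p) = (path_gain Phi s p)^-1.
Proof.
elim: p s => [|x p IH] s /=; first by rewrite !path_gain_nil invr1.
case/andP=> sx xp; rewrite rev_walk_cons -cats1 path_gain_cat IH //.
rewrite last_rev_walk !path_gain_cons path_gain_nil (gain_inv Phi sx) mulr1.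
by rewrite invfM mulrC.
Qed.

Lemma cycle_gain_catC p q : cycle_gain Phi (p ++ q) = cycle_gain Phi (q ++ p).
Proof.
case: p q => [|a p] [|b q]; rewrite ?cats0 //=.
rewrite !rcons_cat !rcons_cons -!cat_rcons !path_gain_cat !last_rcons.
exact: mulrC.
Qed.

Lemma cycle_gain_rot i c : cycle_gain Phi (rot i c) = cycle_gain Phi c.
Proof. by rewrite cycle_gain_catC cat_take_drop. Qed.

Lemma unbalanced_bigon s p t q : path G s (rcons q t) ->
  unbalanced Phi (bigon s p t q) <->
  path_gain Phi s (rcons p t) <> path_gain Phi s (rcons q t).
Proof.
move=> sq; rewrite /unbalanced /= rcons_cat -cat_rcons path_gain_cat last_rcons.
have := path_gain_rev sq; rewrite last_rcons rev_walk_rcons => ->.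
split=> neq eq_gain; apply: neq; last exact: divr1_eq.
by rewrite eq_gain divff ?path_gain_neq0.
Qed.

Lemma max_gainE s t :
  max_gain Phi s t = lex_min >=%R (geodesics G s t)
    (fun p : (dist G s t).-tuple 'I_n => path_gain Phi s p).
Proof. by []. Qed.

Lemma min_gainE s t :
  min_gain Phi s t = lex_min <=%R (geodesics G s t)
    (fun p : (dist G s t).-tuple 'I_n => path_gain Phi s p).
Proof. by []. Qed.

Lemma max_min_gain_eqP s t :
  max_gain Phi s t = min_gain Phi s t <->
  {in geodesics G s t &, forall p q : (dist G s t).-tuple 'I_n,
    path_gain Phi s p = path_gain Phi s q}.
Proof. by rewrite max_gainE min_gainE; apply: lex_max_min_eqP. Qed.

Lemma distance_compatible_ltP :
  distance_compatible Phi <->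
  forall s t, (s < t)%N -> max_gain Phi s t = min_gain Phi s t.
Proof.
split=> [/matrixP eqD s t lt_st | eq_gain].
  have := eqD s t; rewrite !mxE /phi_max /phi_min /std_lt /= lt_st.
  apply: mulIf.
  by rewrite pnatr_eq0 dist_eq0 -(inj_eq val_inj) /= ltn_eqF.
apply/matrixP => s t; rewrite !mxE /phi_max /phi_min /std_lt /=.
have [lt_st|lt_ts|/val_inj <-] := ltngtP s t.
- by rewrite eq_gain.
- by rewrite (eq_gain t s).
- by have/eqP-> : dist G s s == 0%N; rewrite ?dist_eq0 // !mulr0.
Qed.

End Gain.

Section Discordant.
Variables (R : realType) (n : nat) (G : sgraph n) (Phi : gain_graph R G).
Implicit Types (s t : 'I_n) (p q : seq 'I_n).

Definition discordant s p q : Prop :=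
  [/\ min_walk G s p, min_walk G s q, last s p = last s q &
      path_gain Phi s p <> path_gain Phi s q].

Lemma discordant_neq s p q : discordant s p q -> s != last s p.
Proof.
case=> mp mq lpq neq; apply/eqP => ls; apply: neq.
have eq_nil r : min_walk G s r -> last s r = s -> r = [::].
  by move=> mr lr; apply/size0nil/(min_walk_eq_size mr (min_walk_nil _ _)).
by rewrite (eq_nil p mp (esym ls)) (eq_nil q mq) // -lpq.
Qed.

Lemma discordant_rev s p q :
  discordant s p q -> discordant (last s p) (rev_walk s p) (rev_walk s q).
Proof.
case=> mp mq lpq neq; have symG := @adj_sym _ G; split.
- exact: min_walk_rev.
- by rewrite lpq; apply: min_walk_rev.
- by rewrite {2}lpq !last_rev_walk.
- rewrite path_gain_rev ?(min_walk_path mp) // lpq.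
  by rewrite path_gain_rev ?(min_walk_path mq) // => /invr_inj.
Qed.

Lemma discordant_cat s p1 p2 q1 q2 : last s p1 = last s q1 ->
  discordant s (p1 ++ p2) (q1 ++ q2) ->
  discordant s p1 q1 \/ discordant (last s p1) p2 q2.
Proof.
move=> l1 [/min_walk_cat[mp1 mp2] /min_walk_cat[mq1 mq2]].
rewrite !last_cat !path_gain_cat -l1 => l2 neq; rewrite -l1 in mq2.
have [eq1|neq1] := eqVneq (path_gain Phi s p1) (path_gain Phi s q1).
  by right; split=> // eq2; apply: neq; rewrite eq1 eq2.
by left; split=> //; apply/eqP.
Qed.

Lemma discordant_disjoint s p q : discordant s p q ->
  exists s' t p' q',
    discordant s' (rcons p' t) (rcons q' t) /\ ~~ has (mem q') p'.
Proof.
have [m] := ubnP (size p); elim: m s p q => // m IH s p q lt_pm D.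
have := discordant_neq D; case: (D) => mp mq lpq _.
case/lastP: p => [|p t] in lt_pm D mp lpq *; first by rewrite eqxx.
case/lastP: q => [|q t'] in D mq lpq *; first by rewrite lpq eqxx.
move=> _; rewrite !last_rcons in lpq; case: t' / lpq in D mq *.
have [/hasP[x xp xq]|disj] := boolP (has (mem q) p); last by exists s, t, p, q.
case/path.splitP: xp => p1 p2 in lt_pm D mp *.
case/path.splitP: xq => q1 q2 in D mq *.
have lx : last s (rcons p1 x) = last s (rcons q1 x) by rewrite !last_rcons.
rewrite !rcons_cat in D lt_pm; rewrite size_cat !size_rcons in lt_pm.
by case: (discordant_cat lx D); apply: IH; rewrite size_rcons; lia.
Qed.

Lemma distance_compatiblePn :
  ~ distance_compatible Phi <-> exists s p q, discordant s p q.
Proof.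
split=> [|[s [p [q D]]]].
  apply: contra_notP => none.
  apply/distance_compatible_ltP => s t _; apply/max_min_gain_eqP => p q.
  move=> /geodesic_min_walk[mp lp] /geodesic_min_walk[mq lq].
  apply: contrapT => neq; apply: none; exists s, p, q.
  by split=> //; rewrite lp lq.
wlog lt_s : s p q D / s < last s p.
  move=> IH; have [lt_s|lt_s|/val_inj eq_s] := ltngtP s (last s p).
  - exact: IH D lt_s.
  - by apply: IH (discordant_rev D) _; rewrite last_rev_walk.
  - by have := discordant_neq D; rewrite -eq_s eqxx.
move/distance_compatible_ltP/(_ _ _ lt_s)/max_min_gain_eqP => gainE.
case: D => mp mq lpq; apply.
have [p' gp <-] := min_walk_geodesic mp erefl.
by have [q' gq <-] := min_walk_geodesic mq (esym lpq); apply: gainE.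
Qed.

Lemma discordant_bigonP s p t q :
  discordant s (rcons p t) (rcons q t) /\ ~~ has (mem q) p <->
  [/\ is_cycle G (bigon s p t q), size p = size q,
      unbalanced Phi (bigon s p t q) &
      ~ exists r, is_path G s t r /\ size r < (size p).+1].
Proof.
rewrite is_cycle_bigon; split=> [[[mp mq lpq neq] disj] | ].
  have := min_walk_eq_size mp mq lpq; rewrite !size_rcons => -[szpq].
  have := min_walk_is_path mp; have := min_walk_is_path mq.
  rewrite !last_rcons => pq pp; split=> //.
  - rewrite pp pq disj andbT; move: neq szpq.
    by case: (p) (q) => [|a p'] [|b q'].
  - by apply/unbalanced_bigon => //; apply: min_walk_path.
  - by rewrite -(size_rcons p t); apply/(min_walk_is_pathP pp).
case=> /and4P[_ pp pq disj] szpq unb short; split=> //.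
split; rewrite ?last_rcons //.
- by apply/(min_walk_is_pathP pp); rewrite size_rcons.
- by apply/(min_walk_is_pathP pq); rewrite size_rcons -szpq.
- by apply/unbalanced_bigon => //; case/and3P: pq.
Qed.

End Discordant.

Theorem theorem6p4 (R : realType) (n : nat) (G : sgraph n)
    (Phi : gain_graph R G) :
  k_connected G 2 -> ~ geodetic G ->
  (~ distance_compatible Phi <->
   exists (c : seq 'I_n) (l : nat),
     [/\ is_cycle G c, size c = 2 * l, unbalanced Phi c &
         exists s t : 'I_n,
           [/\ s \in c, t \in c, cycle_dist c s t = l &
               ~ exists p : seq 'I_n, is_path G s t p /\ size p < l]]).
Proof.
move=> _ _; rewrite distance_compatiblePn; split.
  case=> s0 [p0 [q0 /discordant_disjoint[s [t [p [q]]]]]].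
  case/discordant_bigonP=> cyc szpq unb short.
  exists (bigon s p t q), (size p).+1; split=> //.
    by rewrite size_bigon -szpq mulnS mul2n -addnn.
  exists s, t; split=> //; rewrite ?cycle_dist_bigon -?szpq ?minnn //.
  - by rewrite inE eqxx.
  - by rewrite inE mem_cat inE eqxx !orbT.
  - by case/and3P: cyc.
case=> c [l [cyc szc unb [s [t [sc tc dst short]]]]].
have /and3P[c_ge3 uc _] := cyc.
have st : s != t.
  by apply/eqP => eq_st; move: dst c_ge3; rewrite eq_st cycle_distxx szc => <-.
have [i [p [q cE]]] := rot_to_bigon uc sc tc st.
rewrite -(cycle_dist_rot i) // cE cycle_dist_bigon -?cE ?rot_uniq // in dst.
have := size_rot i c; rewrite cE size_bigon szc => sz_sum.
have [szpq szp] : size p = size q /\ (size p).+1 = l by lia.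
have [|D _] := iffRL (discordant_bigonP Phi s p t q).
  by rewrite -cE is_cycle_rot /unbalanced cycle_gain_rot szp.
by exists s, (rcons p t), (rcons q t).
Qed.
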